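(* Let $\mathcal{X}=(\mathcal{V},\varrho,\upsilon)$ be a connected strong fuzzy graph such that $\varrho(u)=1$ for all $u\in\varrho^*$ and $|\varrho^*|>1$. Then $$SDI(\mathcal{X})\le|\varrho^*|\,WI(\mathcal{X}).$$
   Context: A fuzzy graph $\mathcal{X}=(\mathcal{V},\varrho,\upsilon)$ consists of a nonempty finite set $\mathcal{V}$ of vertices, a function $\varrho:\mathcal{V}\to[0,1]$ and a symmetric function $\upsilon:\mathcal{V}\times\mathcal{V}\to[0,1]$ with $\upsilon(ab)\le\min(\varrho(a),\varrho(b))$ for all $a,b$, and no loops ($\upsilon(aa)=0$). Put $\varrho^*=\{a:\varrho(a)>0\}$; it is assumed that $\mathcal{V}=\varrho^*$; pairs $ab$ with $\upsilon(ab)>0$ are called edges. A path is a sequence of distinct vertices $a_1,\dots,a_m$ with $\upsilon(a_ia_{i+1})>0$ for all $i<m$; its strength is the minimum of the weights $\upsilon$ of its edges. The strength of connectedness between $a$ and $b$ is the maximum of the strengths of all paths from $a$ to $b$ (and $0$ if there is none). $\mathcal{X}$ is connected if every two vertices are joined by a path. An edge $ab$ is strong if $\upsilon(ab)$ is at least the strength of connectedness between $a$ and $b$ in the fuzzy graph obtained by deleting the edge $ab$. A fuzzy graph is strong if all its edges are strong. A set $\mathcal{D}\subseteq\mathcal{V}$ is a strong dominating set (SDS) if every $b\in\mathcal{V}\setminus\mathcal{D}$ is joined by a strong edge to some $a\in\mathcal{D}$. An SDS $\mathcal{D}$ is a minimal strong dominating set (MSDS) if $\mathcal{D}\setminus\{a\}$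 is not an SDS for every $a\in\mathcal{D}$. The weight of $\mathcal{S}\subseteq\mathcal{V}$ is $W(\mathcal{S})=\sum_{a\in\mathcal{S}}\min\{\upsilon(ab): ab \text{ is a strong edge}\}$. The strong domination degree ${}_{sd}d(u)$ of a vertex $u$ is the minimum of the weights of the MSDSs containing $u$; the strong domination index is $SDI(\mathcal{X})=\sum_{v\in\mathcal{V}}{}_{sd}d(v)$. A strong path is a path all of whose edges are strong. An $a$–$b$ geodesic is a strong path from $a$ to $b$ such that no strong path from $a$ to $b$ is shorter (has fewer edges); its weight is the sum of the weights $\upsilon$ of its edges. $d_s(a,b)$ is the minimum of the weights of the $a$–$b$ geodesics. The Wiener index is $WI(\mathcal{X})=\sum_{a,b\in\varrho^*}\varrho(a)\varrho(b)d_s(a,b)$, the sum being over unordered pairs of distinct vertices. *)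

(* Defs.v *)
From HB Require Import structures.
From mathcomp Require Import all_boot all_order all_algebra.
Set Implicit Arguments.
Unset Strict Implicit.
Unset Printing Implicit Defensive.
Import Order.TTheory GRing.Theory Num.Theory.
Local Open Scope ring_scope.

Record fuzzy_graph (R : realFieldType) (V : finType) := FuzzyGraph {
  rho : V -> R;
  ups : V -> V -> R;
  fg_nonempty : (0 < #|V|)%N;
  rho_itv01 : forall a, 0 <= rho a <= 1;
  ups_itv01 : forall a b, 0 <= ups a b <= 1;
  upsC : forall a b, ups a b = ups b a;
  ups_le_min : forall a b, ups a b <= Num.min (rho a) (rho b);
  upsxx : forall a, ups a a = 0
}.

(* Equals 0 on the empty list; on a nonempty list the initial value [head 0 s]
   belongs to [s], so this is the true minimum (see the next two lemmas). *)
Definition seq_min (R : realFieldType) (s : seq R) : R :=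
  \big[Order.min/head 0 s]_(x <- s) x.

Lemma seq_min_mem (R : realFieldType) (s : seq R) :
  s != [::] -> seq_min s \in s.
Proof.
case: s => [//|x0 s] _; rewrite /seq_min /=.
have : forall t, {subset t <= x0 :: s} ->
    \big[Order.min/x0]_(x <- t) x \in x0 :: s.
  elim=> [|y t IHt] sub; first by rewrite big_nil mem_head.
  rewrite big_cons minEle; case: ifP => _; first by rewrite sub ?mem_head.
  by apply: IHt => z zt; apply: sub; rewrite inE zt orbT.
by apply.
Qed.

Lemma seq_min_le (R : realFieldType) (s : seq R) (x : R) :
  x \in s -> seq_min s <= x.
Proof.
rewrite /seq_min; elim: s (head 0 s) => [//|y s IHs] x0.
rewrite inE big_cons ge_min => /orP[/eqP->|/IHs->]; first by rewrite lexx.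
by rewrite orbT.
Qed.

(* The path a, p_1, ..., p_m is represented by its first vertex [a] and the
   list [p] of the following ones; [size p] is its number of edges. *)
Definition is_path (V : finType) (e : rel V) (a b : V) (p : seq V) : bool :=
  [&& path e a p, uniq (a :: p) & last a p == b].

Definition all_paths (V : finType) (e : rel V) (a b : V) : seq (seq V) :=
  [seq p <- flatten [seq [seq val t | t : n.-tuple V] | n <- iota 0 #|V|]
  | is_path e a b p].

Lemma mem_all_paths (V : finType) (e : rel V) (a b : V) (p : seq V) :
  (p \in all_paths e a b) = is_path e a b p.
Proof.
rewrite mem_filter andb_idr // => /and3P[_ up _].
apply/flatten_mapP; exists (size p).
  by rewrite mem_iota add0n; have /= <- := card_uniqP up; apply: max_card.
by apply/imageP; exists (in_tuple p).
Qed.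

Section FuzzyGraphNotions.
Variables (R : realFieldType) (V : finType).
Implicit Types (X : fuzzy_graph R V) (a b u : V) (p : seq V) (D S : {set V}).

Definition fg_support X : {set V} := [set a | 0 < rho X a].

Definition edge X : rel V := fun a b => 0 < ups X a b.

Definition edge_weights X a p : seq R := pairmap (ups X) a p.

Definition path_strength X a p : R := seq_min (edge_weights X a p).

Definition path_weight X a p : R := \sum_(w <- edge_weights X a p) w.

Definition conn_strength X a b : R :=
  \big[Order.max/0]_(p <- all_paths (edge X) a b) path_strength X a p.

Definition connected X : Prop :=
  forall a b, exists p, is_path (edge X) a b p.

Definition del_ups X a b : V -> V -> R := fun x y =>
  if ((x == a) && (y == b)) || ((x == b) && (y == a)) then 0 else ups X x y.

Definition del_edge X a b : fuzzy_graph R V.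
Proof.
refine (@FuzzyGraph R V (rho X) (del_ups X a b) _ _ _ _ _ _);
  case: X => r v V0 r01 v01 vC vr vv; rewrite /del_ups //=.
- by move=> x y; case: ifP => // _; rewrite lexx ler01.
- by move=> x y; rewrite vC orbC [_ && (x == a)]andbC [_ && (x == b)]andbC.
- move=> x y; case: ifP => // _; rewrite le_min.
  by case/andP: (r01 x) => -> _; case/andP: (r01 y).
- by move=> x; case: ifP.
Defined.

Definition strong_edge X : rel V := fun a b =>
  edge X a b && (conn_strength (del_edge X a b) a b <= ups X a b).

Definition strong X : Prop := forall a b, edge X a b -> strong_edge X a b.

Definition sds X D : bool :=
  [forall b in ~: D, exists a in D, strong_edge X a b].

Definition msds X D : bool :=
  sds X D && [forall a in D, ~~ sds X (D :\ a)].

Definition set_weight X S : R :=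
  \sum_(a in S) seq_min [seq ups X a b | b in strong_edge X a].

Definition strong_domination_degree X u : R :=
  seq_min [seq set_weight X D | D in [pred D | msds X D & u \in D]].

Definition SDI X : R := \sum_(v : V) strong_domination_degree X v.

Definition geodesics X a b : seq (seq V) :=
  [seq p <- all_paths (strong_edge X) a b
  | all (fun q => size p <= size q)%N (all_paths (strong_edge X) a b)].

Definition geodesic_dist X a b : R :=
  seq_min [seq path_weight X a p | p <- geodesics X a b].

(* Each unordered pair of distinct vertices occurs exactly once, ordered by
   the enumeration of [V]; the summand is symmetric in [a] and [b]. *)
Definition WI X : R :=
  \sum_(a in fg_support X) \sum_(b in fg_support X | (enum_rank a < enum_rank b)%N)
    rho X a * rho X b * geodesic_dist X a b.

End FuzzyGraphNotions.

(* Main.v *)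
Require Import Defs.
From mathcomp Require Import all_boot all_order all_algebra.
Import Order.TTheory GRing.Theory Num.Theory.
Local Open Scope ring_scope.

(** For each vertex [u], a maximal independent set [D] containing [u] is a
    minimal strong dominating set, and it omits every neighbour [b0] of [u].
    The pairs [{a, b0}] with [a] in [D] are distinct, and [d_s(a, b0)] is at
    least the weight of the edge leaving [a], hence at least the contribution
    of [a] to [W(D)].  So [W(D) <= WI], and one sums over [u]. *)

(** The summand of [set_weight]. At a vertex without strong edges it is 0, the default value of
    [seq_min]. *)
Definition min_strong_weight (R : realFieldType) (V : finType)
    (X : fuzzy_graph R V) (a : V) : R :=
  seq_min [seq ups X a b | b in strong_edge X a].
Arguments min_strong_weight {R V} X a.

Definition independent (V : finType) (e : rel V) (D : {set V}) : bool :=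
  [forall a in D, forall b in D, ~~ e a b].
Arguments independent {V} e D.

Lemma independentP (V : finType) (e : rel V) (D : {set V}) :
  reflect {in D &, forall a b, ~~ e a b} (independent e D).
Proof.
apply: (iffP forall_inP) => [H a b aD bD|H a aD].
  by move/forall_inP: (H a aD); apply.
by apply/forall_inP => b bD; apply: H.
Qed.

Section FuzzyGraph.
Variables (R : realFieldType) (V : finType) (X : fuzzy_graph R V).

Lemma ups_ge0 (a b : V) : 0 <= ups X a b.
Proof. by case/andP: (ups_itv01 X a b). Qed.

Lemma edge_sym : symmetric (edge X).
Proof. by move=> a b; rewrite /edge upsC. Qed.

Lemma edge_irrefl (a : V) : edge X a a = false.
Proof. by rewrite /edge upsxx ltxx. Qed.

Lemma min_strong_weight_le (a b : V) :
  strong_edge X a b -> min_strong_weight X a <= ups X a b.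
Proof. by move=> ab; apply/seq_min_le/image_f. Qed.

Lemma min_strong_weight_ge0 (a : V) : 0 <= min_strong_weight X a.
Proof.
rewrite /min_strong_weight; set s := image _ _.
have [->|/seq_min_mem/imageP[b _ ->]] := eqVneq s [::]; last exact: ups_ge0.
by rewrite /seq_min big_nil.
Qed.

Lemma path_weight_ge0 (a : V) (p : seq V) : 0 <= path_weight X a p.
Proof.
rewrite /path_weight /edge_weights.
elim: p a => [|b p IHp] a /=; first by rewrite big_nil.
by rewrite big_cons addr_ge0 ?ups_ge0.
Qed.

Lemma path_weight_ge_head (a b : V) (p : seq V) :
  ups X a b <= path_weight X a (b :: p).
Proof. by rewrite /path_weight /= big_cons lerDl path_weight_ge0. Qed.

Lemma path_weight_ge_last (a b : V) (p : seq V) :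
  ups X (last a p) b <= path_weight X a (rcons p b).
Proof.
rewrite /path_weight /edge_weights -cats1 pairmap_cat big_cat /= big_seq1.
by rewrite lerDr path_weight_ge0.
Qed.

Hypothesis strongX : strong X.

Lemma strong_edgeE : strong_edge X =2 edge X.
Proof. by move=> a b; apply/idP/idP => [/andP[]|/strongX]. Qed.

(** Maximality gives domination: an undominated vertex could be added to [D]. Independence gives
    minimality: a vertex removed from [D] has no neighbour left to dominate it. *)
Lemma max_independent_msds (D : {set V}) :
  maxset (independent (edge X)) D -> msds X D.
Proof.
case/maxsetP => /independentP indD maxD; apply/andP; split.
  apply/forall_inP => b; rewrite inE => bD; apply/exists_inP.
  have [/exists_inP[a aD ab]|] := boolP [exists a in D, edge X a b].
    by exists a => //; rewrite strong_edgeE.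
  move/exists_inPn => nob; case/negP: bD.
  (* It suffices that [b |: D] is independent, since it then equals [D] by maximality and so [b]
     lies in [D]. *)
  rewrite -(maxD (b |: D)) ?setU11 ?subsetUr //; apply/independentP.
  move=> x y /setU1P[->|xD] /setU1P[->|yD]; first by rewrite edge_irrefl.
  - by rewrite edge_sym nob.
  - exact: nob.
  - exact: indD.
(* The vertex that [D :\ a] fails to dominate is [a] itself. *)
apply/forall_inP => a aD; apply/negP => /forall_inP/(_ a).
rewrite !inE eqxx => /(_ isT)/exists_inP[c /setD1P[_ cD]].
by rewrite strong_edgeE; apply/negP/indD.
Qed.

Hypothesis connectedX : connected X.

(** Since all edges are strong, connectedness provides a strong path; one of least length is a
    geodesic. *)
Lemma geodesics_neq0 (a b : V) : geodesics X a b != [::].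
Proof.
have [p0 p0P] := connectedX a b.
have : exists n, has (fun p => size p == n) (all_paths (strong_edge X) a b).
  exists (size p0); apply/hasP; exists p0 => //; rewrite mem_all_paths.
  by rewrite /is_path (eq_path strong_edgeE).
case/ex_minnP => n /hasP[p pP /eqP sp] min_n.
suff: p \in geodesics X a b by case: (geodesics X a b).
rewrite mem_filter pP andbT; apply/allP => q qP; rewrite sp.
by apply/min_n/hasP; exists q.
Qed.

(** The list of geodesics is nonempty, so [geodesic_dist] is an attained minimum and not the default
    0 of [seq_min]. *)
Lemma geodesic_distP (a b : V) :
  exists2 p, is_path (edge X) a b p & geodesic_dist X a b = path_weight X a p.
Proof.
have /seq_min_mem/mapP[p] :
    [seq path_weight X a p | p <- geodesics X a b] != [::].
  by have := geodesics_neq0 a b; case: (geodesics X a b).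
rewrite mem_filter mem_all_paths /is_path (eq_path strong_edgeE).
by case/andP=> _ pP geoE; exists p; rewrite // /geodesic_dist geoE.
Qed.

Lemma geodesic_dist_ge0 (a b : V) : 0 <= geodesic_dist X a b.
Proof. by have [p _ ->] := geodesic_distP a b; apply: path_weight_ge0. Qed.

(** The first edge of the path realizing the distance is a strong edge at [a], and the other weights
    are nonnegative. *)
Lemma geodesic_dist_ge_l (a b : V) :
  a != b -> min_strong_weight X a <= geodesic_dist X a b.
Proof.
move=> ab; have [[|c p] /and3P[+ _ lp] ->] := geodesic_distP a b.
  by rewrite lp in ab.
case/andP=> /strongX/min_strong_weight_le ac _.
exact: le_trans ac (path_weight_ge_head _ _ _).
Qed.

(** The same argument with the last edge, which is a strong edge at [b]. *)
Lemma geodesic_dist_ge_r (a b : V) :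
  a != b -> min_strong_weight X b <= geodesic_dist X a b.
Proof.
move=> ab; have [p + ->] := geodesic_distP a b.
case/lastP: p => [|p c] /and3P[pp _ lp]; first by rewrite lp in ab.
move: pp lp; rewrite rcons_path last_rcons => /andP[_ pc] /eqP cb.
rewrite cb edge_sym in pc *.
move/strongX/min_strong_weight_le: pc; rewrite upsC => /le_trans; apply.
exact: path_weight_ge_last.
Qed.

Lemma connected_neighbour (u : V) : (1 < #|V|)%N -> exists b, edge X u b.
Proof.
move=> V1; have [v vu] : exists v, v != u.
  have /card_gt0P[v] : (0 < #|predC1 u|)%N by rewrite cardC1 -ltnS prednK // ltnW.
  by exists v.
have [[|b p] /and3P[+ _ lp]] := connectedX u v; first by rewrite eq_sym lp in vu.
by case/andP=> ub _; exists b.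
Qed.

(** Each vertex [a] other than [b0] is charged to the pair of [a] and [b0]; every other pair
    contributes a nonnegative distance to [WI]. *)
Lemma sum_min_strong_weight_le_WI (b0 : V) :
  fg_support X = [set: V] -> (forall u, u \in fg_support X -> rho X u = 1) ->
  \sum_(a | a != b0) min_strong_weight X a <= WI X.
Proof.
move=> suppX rho1; pose m := min_strong_weight X.
pose lt (a b : V) := (enum_rank a < enum_rank b)%N.
have -> : WI X = \sum_a \sum_(b | lt a b) geodesic_dist X a b.
  rewrite /WI suppX; apply: eq_big => [a|a _]; first by rewrite inE.
  apply: eq_big => [b|b _]; first by rewrite inE.
  by rewrite !rho1 ?suppX ?inE // !mul1r.
(* The left side is spread over the ordered pairs indexing [WI], so that the comparison is termwise.
   The two conditionals cover [b0] as the larger or the smaller member of the pair. *)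
have -> : \sum_(a | a != b0) m a =
    \sum_a \sum_(b | lt a b) ((if b == b0 then m a else 0)
                              + (if a == b0 then m b else 0)).
  under [RHS]eq_bigr => a _ do rewrite big_split /=.
  rewrite big_split /=.
  have -> : \sum_a \sum_(b | lt a b) (if b == b0 then m a else 0) =
      \sum_(a | lt a b0) m a.
    rewrite [RHS]big_mkcond; apply: eq_bigr => a _.
    rewrite big_mkcond (bigD1 b0) //= eqxx big1 ?addr0 // => b /negPf ->.
    by rewrite if_same.
  have -> : \sum_a \sum_(b | lt a b) (if a == b0 then m b else 0) =
      \sum_(b | lt b0 b) m b.
    rewrite (bigD1 b0) //= [X in _ + X]big1 => [|a /negPf nab].
      by rewrite addr0; apply: eq_bigr => b _; rewrite eqxx.
    by rewrite big1 // => b _; rewrite nab.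
  (* By injectivity of [enum_rank], a vertex other than [b0] ranks either strictly below or strictly
     above it. *)
  rewrite (bigID (lt^~ b0)) /=; congr (_ + _); apply: eq_bigl => a;
    rewrite -(inj_eq enum_rank_inj) -(inj_eq val_inj) /lt /=; by case: ltngtP.
apply: ler_sum => a _; apply: ler_sum => b ltab.
have ab : a != b by apply: contraTneq ltab => ->; rewrite /lt ltnn.
have [bb0|_] := eqVneq b b0; have [ab0|_] := eqVneq a b0.
- by rewrite ab0 bb0 eqxx in ab.
- by rewrite addr0 geodesic_dist_ge_l.
- by rewrite add0r geodesic_dist_ge_r.
- by rewrite addr0 geodesic_dist_ge0.
Qed.

Lemma strong_domination_degree_le_WI (u : V) :
  fg_support X = [set: V] -> (forall v, v \in fg_support X -> rho X v = 1) ->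
  (1 < #|V|)%N -> strong_domination_degree X u <= WI X.
Proof.
move=> suppX rho1 V1; have [b0 ub0] := connected_neighbour u V1.
have ind_u : independent (edge X) [set u].
  by apply/independentP => a b /set1P-> /set1P->; rewrite edge_irrefl.
have [D maxD] := maxset_exists ind_u; rewrite sub1set => uD.
have b0D : b0 \notin D.
  apply/negP => b0D; have /independentP/(_ u b0 uD b0D) := maxsetp maxD.
  by rewrite ub0.
apply: le_trans (sum_min_strong_weight_le_WI b0 suppX rho1).
apply: (@le_trans _ _ (set_weight X D)).
  by apply/seq_min_le/image_f; rewrite inE /= max_independent_msds.
(* Both sums are extended by zero to all of [V]: [D] avoids [b0], and the terms outside [D] are
   nonnegative. *)
rewrite /set_weight [leLHS]big_mkcond [leRHS]big_mkcond /=.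
apply: ler_sum => a _; have [->|_] := eqVneq a b0; first by rewrite (negPf b0D).
by case: ifP => // _; apply: min_strong_weight_ge0.
Qed.

End FuzzyGraph.

Theorem proposition4p19 (R : realFieldType) (V : finType)
    (X : fuzzy_graph R V)
    (hV : fg_support X = [set: V])
    (hconn : connected X)
    (hstrong : strong X)
    (hrho : forall u : V, u \in fg_support X -> rho X u = 1)
    (hcard : (1 < #|fg_support X|)%N) :
  SDI X <= #|fg_support X|%:R * WI X.
Proof.
have V1 : (1 < #|V|)%N by rewrite -cardsT -hV.
rewrite hV cardsT mulr_natl -sumr_const; apply: ler_sum => u _.
exact: strong_domination_degree_le_WI.
Qed.
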